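(* Let $u^{\mathrm{scb}}$ and $u^{\mathrm a}$ be the (lattice-interpolated) linearised surface Cauchy–Born solution and the linearised atomistic solution defined in the context, and define the mean strain error $$\overline{\mathrm{Err}}:=\left|\frac{\sum_{\ell=0}^\infty(u^{\mathrm{scb}}_\ell-u^{\mathrm a}_\ell)}{\sum_{\ell=0}^\infty u^{\mathrm a}_\ell}\right|.$$ Asymptotically as $\alpha\to\infty$, the mean strain error satisfies $$\overline{\mathrm{Err}}=2\Big(1-\frac1{h_0}\Big)e^{-\alpha}+O(e^{-2\alpha}).$$
   Context: Morse potential: for the stiffness parameter $\alpha\ge 1+\sqrt3$, $$\phi(r)=e^{-2\alpha(r-r_0)}-2e^{-\alpha(r-r_0)}-\phi_0,\qquad r_0=1+\frac1\alpha\log\Big(\frac{1+2e^{-\alpha}}{1+2e^{-2\alpha}}\Big),\qquad r\in\mathbb{R}.$$ $W(r):=\phi(r)+\phi(2r)$; the value of $r_0$ is such that $W'(1)=0$, and the constant $\phi_0$ is chosen such that $W(1)=0$. The surface energy is $\gamma(F):=-\tfrac12\phi(2F)$. The mesh is a strictly increasing integer sequence $0=X_0<X_1<\dots$, independent of $\alpha$, with $h_j:=X_{j+1}-X_j$ (so $h_0\ge1$ is an integer). Linearised surface Cauchy–Born solution: $$U^{\mathrm{scb}}_0=\frac{-\gamma'(1)}{h_0W''(1)+\gamma''(1)},\qquad U^{\mathrm{scb}}_j=0\quad(j\ge1).$$ It is the solution of $\delta E(0)+\delta^2E(0)U=0$ for $E(U)=\sum_{j\ge0}h_jW(1+U_j)+\gamma(1+U_0)$.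 It is interpolated to a lattice function $u^{\mathrm{scb}}=(u^{\mathrm{scb}}_\ell)_{\ell\ge0}$ by $u^{\mathrm{scb}}_\ell=U^{\mathrm{scb}}_j$ for $\ell=X_j,\dots,X_{j+1}-1$, $j\ge0$. Linearised atomistic solution: $$u^{\mathrm a}_\ell=\frac{\phi'(2)\lambda^\ell}{\phi''(1)+\phi''(2)(1+\lambda)}\quad(\ell\ge0),$$ where $\lambda$ is the unique solution in $(0,1)$ of $\phi''(2)\lambda^2+[\phi''(1)+2\phi''(2)]\lambda+\phi''(2)=0$, that is, $$\lambda=\frac{\sqrt{1+4\beta}-1-2\beta}{2\beta},\qquad \beta=\frac{\phi''(2)}{\phi''(1)}.$$ It is the decaying solution of $\delta E(0)+\delta^2E(0)u=0$ for $E(u)=\sum_{\ell\ge0}[\phi(1+u_\ell)+\phi(2+u_\ell+u_{\ell+1})]$. *)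

(* Defs.v *)
(* Stdlib reals with Coquelicot. *)
From Stdlib Require Import Reals Lra Lia.
From Coquelicot Require Import Coquelicot.
Open Scope R_scope.

Definition r0 (alpha : R) : R :=
  1 + / alpha * ln ((1 + 2 * exp (- alpha)) / (1 + 2 * exp (- (2 * alpha)))).

Definition morse (alpha r : R) : R :=
  exp (- (2 * alpha) * (r - r0 alpha)) - 2 * exp (- alpha * (r - r0 alpha)).

(* The only constant giving [W alpha 1 = 0]; see [W_at_1]. *)
Definition phi0 (alpha : R) : R := (morse alpha 1 + morse alpha 2) / 2.

Definition phi (alpha r : R) : R := morse alpha r - phi0 alpha.

Definition W (alpha r : R) : R := phi alpha r + phi alpha (2 * r).

Definition gamma (alpha F : R) : R := - (1 / 2) * phi alpha (2 * F).

Definition is_mesh (X : nat -> nat) : Prop :=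
  X 0%nat = 0%nat /\ forall j : nat, (X j < X (S j))%nat.

Definition mesh_size (X : nat -> nat) (j : nat) : R := INR (X (S j) - X j).

(* The index [j] with [X j <= l < X (S j)]; see [cell_spec]. *)
Fixpoint cell (X : nat -> nat) (l : nat) : nat :=
  match l with
  | O => O
  | S l' => if (X (S (cell X l')) <=? l)%nat then S (cell X l') else cell X l'
  end.

Definition interpolate (X : nat -> nat) (U : nat -> R) (l : nat) : R :=
  U (cell X l).

Definition U_scb (alpha : R) (X : nat -> nat) (j : nat) : R :=
  match j with
  | O => - Derive (gamma alpha) 1 /
         (mesh_size X 0 * Derive_n (W alpha) 2 1 + Derive_n (gamma alpha) 2 1)
  | S _ => 0
  end.

Definition u_scb (alpha : R) (X : nat -> nat) : nat -> R :=
  interpolate X (U_scb alpha X).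

Definition beta (alpha : R) : R :=
  Derive_n (phi alpha) 2 2 / Derive_n (phi alpha) 2 1.

(* For [1 + sqrt 3 <= alpha] this is the only root of the characteristic
   equation in the open interval from 0 to 1; see [lambda_spec]. *)
Definition lambda (alpha : R) : R :=
  (sqrt (1 + 4 * beta alpha) - 1 - 2 * beta alpha) / (2 * beta alpha).

Definition u_a (alpha : R) (l : nat) : R :=
  Derive (phi alpha) 2 * lambda alpha ^ l /
  (Derive_n (phi alpha) 2 1 + Derive_n (phi alpha) 2 2 * (1 + lambda alpha)).

Definition mean_strain_error (X : nat -> nat) (alpha : R) : R :=
  Rabs (Series (fun l : nat => u_scb alpha X l - u_a alpha l) /
        Series (u_a alpha)).

Definition bigO_at_infinity (f g : R -> R) : Prop :=
  exists C : R,
    Rbar_locally p_infty (fun x : R => Rabs (f x) <= C * Rabs (g x)).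

Lemma W_at_1 (alpha : R) : W alpha 1 = 0.
Proof.
  unfold W, phi, phi0. replace (2 * 1) with 2 by ring. field.
Qed.

Lemma cell_spec (X : nat -> nat) (l : nat) :
  is_mesh X -> (X (cell X l) <= l < X (S (cell X l)))%nat.
Proof.
  intros [H0 HX]. induction l as [|l IH].
  - simpl. specialize (HX 0%nat). lia.
  - cbn [cell]. destruct (Nat.leb_spec (X (S (cell X l))) (S l)).
    + specialize (HX (S (cell X l))). lia.
    + lia.
Qed.

Lemma interpolate_spec (X : nat -> nat) (U : nat -> R) (j l : nat) :
  is_mesh X -> (X j <= l < X (S j))%nat -> interpolate X U l = U j.
Proof.
  intros HX Hl. unfold interpolate. f_equal.
  assert (Hc := cell_spec X l HX).
  assert (mono : forall m n : nat, (m <= n)%nat -> (X m <= X n)%nat).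
  { intros m n Hmn. induction Hmn as [|n _ IH]; [lia|].
    destruct HX as [_ HX]. specialize (HX n). lia. }
  destruct (Nat.lt_trichotomy (cell X l) j) as [H|[H|H]]; [|exact H|].
  - specialize (mono _ _ H). lia.
  - specialize (mono _ _ H). lia.
Qed.

Lemma Derive_phi (alpha r : R) :
  Derive (phi alpha) r =
    - (2 * alpha) * exp (- (2 * alpha) * (r - r0 alpha))
    + 2 * alpha * exp (- alpha * (r - r0 alpha)).
Proof.
  apply is_derive_unique. unfold phi, morse. auto_derive; [exact I|].
  rewrite <- !Rminus_def. ring.
Qed.

Lemma Derive2_phi (alpha r : R) :
  Derive_n (phi alpha) 2 r =
    4 * alpha ^ 2 * exp (- (2 * alpha) * (r - r0 alpha))
    - 2 * alpha ^ 2 * exp (- alpha * (r - r0 alpha)).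
Proof.
  change (Derive_n (phi alpha) 2 r) with (Derive (Derive (phi alpha)) r).
  rewrite (Derive_ext _ _ _ (Derive_phi alpha)).
  apply is_derive_unique. auto_derive; [exact I|].
  rewrite <- !Rminus_def. ring.
Qed.

Lemma exp_r0 (alpha : R) : alpha <> 0 ->
  exp (- alpha * (1 - r0 alpha)) =
    (1 + 2 * exp (- alpha)) / (1 + 2 * exp (- alpha) ^ 2).
Proof.
  intros Ha. unfold r0.
  assert (E : exp (- (2 * alpha)) = exp (- alpha) ^ 2).
  { simpl. rewrite Rmult_1_r, <- exp_plus. f_equal. ring. }
  rewrite E. set (x := exp (- alpha)). assert (0 < x) by apply exp_pos.
  match goal with |- exp ?t = ?q => replace t with (ln q) by (field; auto) end.
  apply exp_ln. apply Rdiv_lt_0_compat; nra.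
Qed.

Lemma exp_split (alpha : R) :
  let y := exp (- alpha * (1 - r0 alpha)) in
  exp (- (2 * alpha) * (1 - r0 alpha)) = y ^ 2 /\
  exp (- alpha * (2 - r0 alpha)) = y * exp (- alpha) /\
  exp (- (2 * alpha) * (2 - r0 alpha)) = y ^ 2 * exp (- alpha) ^ 2.
Proof.
  cbv zeta. simpl. rewrite !Rmult_1_r, <- !exp_plus.
  repeat split; f_equal; ring.
Qed.

Lemma Derive_W_at_1 (alpha : R) : alpha <> 0 -> Derive (W alpha) 1 = 0.
Proof.
  intros Ha.
  assert (H : is_derive (W alpha) 1
                (Derive (phi alpha) 1 + 2 * Derive (phi alpha) 2)).
  { rewrite !Derive_phi. unfold W, phi, morse. auto_derive; [exact I|].
    rewrite <- !Rminus_def. replace (2 * 1) with 2 by ring. ring. }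
  rewrite (is_derive_unique _ _ _ H), !Derive_phi.
  destruct (exp_split alpha) as [E1 [E2 E3]]. rewrite E1, E2, E3, (exp_r0 _ Ha).
  assert (0 < exp (- alpha)) by apply exp_pos.
  field. nra.
Qed.

Lemma beta_bounds (alpha : R) : 1 + sqrt 3 <= alpha ->
  0 < Derive_n (phi alpha) 2 1 /\ - (1 / 4) < beta alpha < 0.
Proof.
  intros Ha. assert (1 < sqrt 3).
  { rewrite <- sqrt_1. apply sqrt_lt_1; lra. }
  assert (Ha0 : alpha <> 0) by lra.
  unfold beta. rewrite !Derive2_phi.
  destruct (exp_split alpha) as [E1 [E2 E3]]. rewrite E1, E2, E3, (exp_r0 _ Ha0).
  set (x := exp (- alpha)).
  assert (Hx : 0 < x < 1 / 4).
  { split; [apply exp_pos|]. unfold x. rewrite exp_Ropp.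
    assert (He : 4 < exp alpha).
    { replace alpha with (alpha / 2 + alpha / 2) by lra. rewrite exp_plus.
      assert (1 + alpha / 2 < exp (alpha / 2)) by (apply exp_ineq1; lra). nra. }
    unfold Rdiv. rewrite Rmult_1_l. apply Rinv_lt_contravar; nra. }
  set (q := (1 + 2 * x) / (1 + 2 * x ^ 2)).
  assert (Hq : q * (1 + 2 * x ^ 2) = 1 + 2 * x) by (unfold q; field; nra).
  assert (q1 : 1 < q) by nra.
  assert (q2 : 2 * q * x < 1) by nra.
  assert (a2 : 0 < alpha ^ 2) by nra.
  assert (D : 0 < 4 * alpha ^ 2 * q ^ 2 - 2 * alpha ^ 2 * q).
  { replace (4 * alpha ^ 2 * q ^ 2 - 2 * alpha ^ 2 * q)
      with (alpha ^ 2 * (2 * q * (2 * q - 1))) by ring.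
    apply Rmult_lt_0_compat; nra. }
  split; [exact D|].
  replace ((4 * alpha ^ 2 * (q ^ 2 * x ^ 2) - 2 * alpha ^ 2 * (q * x)) /
           (4 * alpha ^ 2 * q ^ 2 - 2 * alpha ^ 2 * q))
    with (- (x * (1 - 2 * q * x) / (2 * q - 1))) by (field; repeat split; nra).
  assert (0 < x * (1 - 2 * q * x) / (2 * q - 1))
    by (apply Rdiv_lt_0_compat; nra).
  assert (x * (1 - 2 * q * x) / (2 * q - 1) < 1 / 4).
  { apply (Rmult_lt_reg_r (2 * q - 1)); [lra|].
    replace (x * (1 - 2 * q * x) / (2 * q - 1) * (2 * q - 1))
      with (x * (1 - 2 * q * x)) by (field; lra).
    assert (0 < q * x) by nra. nra. }
  lra.
Qed.

Lemma lambda_spec (alpha : R) : 1 + sqrt 3 <= alpha ->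
  forall l : R,
    (0 < l < 1 /\
     Derive_n (phi alpha) 2 2 * l ^ 2
     + (Derive_n (phi alpha) 2 1 + 2 * Derive_n (phi alpha) 2 2) * l
     + Derive_n (phi alpha) 2 2 = 0)
    <-> l = lambda alpha.
Proof.
  intros Ha l. destruct (beta_bounds alpha Ha) as [D Hb].
  assert (B : Derive_n (phi alpha) 2 2 = beta alpha * Derive_n (phi alpha) 2 1)
    by (unfold beta; field; lra).
  rewrite B. set (d := Derive_n (phi alpha) 2 1) in *. unfold lambda.
  set (b := beta alpha) in *.
  set (s := sqrt (1 + 4 * b)).
  assert (Hs : s * s = 1 + 4 * b) by (apply sqrt_sqrt; lra).
  assert (s0 : 0 < s) by (apply sqrt_lt_R0; lra).
  assert (s1 : s < 1) by nra.
  set (m := (s - 1 - 2 * b) / (2 * b)).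
  assert (Hm : b * m ^ 2 + (1 + 2 * b) * m + b = 0).
  { unfold m. replace (b * ((s - 1 - 2 * b) / (2 * b)) ^ 2
      + (1 + 2 * b) * ((s - 1 - 2 * b) / (2 * b)) + b)
      with ((s * s - (1 + 4 * b)) / (4 * b)) by (field; lra).
    rewrite Hs. unfold Rdiv. ring. }
  assert (Hm' : 2 * b * m = s - 1 - 2 * b) by (unfold m; field; lra).
  assert (m01 : 0 < m < 1) by (split; nra).
  split.
  - intros [Hl E].
    assert (E' : b * l ^ 2 + (1 + 2 * b) * l + b = 0).
    { apply (Rmult_eq_reg_l d); [|lra]. rewrite Rmult_0_r, <- E. ring. }
    assert (F : (l - m) * (b * (1 - l * m)) = 0).
    { transitivity (m * (b * l ^ 2 + (1 + 2 * b) * l + b) * -1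
                    + l * (b * m ^ 2 + (1 + 2 * b) * m + b)).
      - ring.
      - rewrite E', Hm. ring. }
    destruct (Rmult_integral _ _ F) as [G|G]; [lra|nra].
  - intros ->. split; [exact m01|].
    replace (b * d * m ^ 2 + (d + 2 * (b * d)) * m + b * d)
      with (d * (b * m ^ 2 + (1 + 2 * b) * m + b)) by ring.
    rewrite Hm. ring.
Qed.

(* Main.v *)
(* With [b = - beta], summing the geometric series and using the characteristic
   equation of [lambda] gives [phi'(2) / (phi''(1) * sqrt (1 - 4 * b))] for the
   total atomistic strain, while the total surface Cauchy-Born strain is
   [phi'(2) / (phi''(1) * (1 - 4 * b + 2 * b / h_0))]. Hence the error is
   [| sqrt (1 - 4 * b) / (1 - 4 * b + 2 * b / h_0) - 1 |], and the claim follows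
   by expanding to first order in [b], where [b = exp (- alpha)] up to a term
   [O (exp (- 2 * alpha))]. *)
Require Import Defs.
From Stdlib Require Import Reals Lra Lia.
From Coquelicot Require Import Coquelicot.
Open Scope R_scope.

(** * Derivatives of [phi], [gamma] and [W] *)

Lemma is_derive_phi (alpha r : R) :
  is_derive (phi alpha) r (Derive (phi alpha) r).
Proof.
  apply Derive_correct. unfold phi, morse. auto_derive. exact I.
Qed.

Lemma is_derive_Derive_phi (alpha r : R) :
  is_derive (Derive (phi alpha)) r (Derive_n (phi alpha) 2 r).
Proof.
  apply Derive_correct.
  eapply ex_derive_ext.
  { intros t. symmetry. apply Derive_phi. }
  auto_derive. exact I.
Qed.

Lemma is_derive_comp_double (f : R -> R) (F l : R) :
  is_derive f (2 * F) l -> is_derive (fun x => f (2 * x)) F (2 * l).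
Proof.
  intros H.
  apply (is_derive_comp f (fun x => 2 * x) F l 2 H).
  auto_derive; [exact I|ring].
Qed.

Lemma Derive_gamma (alpha F : R) :
  Derive (gamma alpha) F = - Derive (phi alpha) (2 * F).
Proof.
  apply is_derive_unique.
  replace (- Derive (phi alpha) (2 * F))
    with (- (1 / 2) * (2 * Derive (phi alpha) (2 * F))) by field.
  apply (is_derive_scal (fun x => phi alpha (2 * x)) F (- (1 / 2))).
  apply is_derive_comp_double, is_derive_phi.
Qed.

Lemma Derive2_gamma (alpha F : R) :
  Derive_n (gamma alpha) 2 F = -2 * Derive_n (phi alpha) 2 (2 * F).
Proof.
  change (Derive_n (gamma alpha) 2 F) with (Derive (Derive (gamma alpha)) F).
  rewrite (Derive_ext _ _ _ (Derive_gamma alpha)).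
  apply is_derive_unique.
  replace (-2 * Derive_n (phi alpha) 2 (2 * F))
    with (- (2 * Derive_n (phi alpha) 2 (2 * F))) by ring.
  apply (is_derive_opp (fun x => Derive (phi alpha) (2 * x))).
  apply is_derive_comp_double, is_derive_Derive_phi.
Qed.

Lemma Derive_W (alpha r : R) :
  Derive (W alpha) r = Derive (phi alpha) r + 2 * Derive (phi alpha) (2 * r).
Proof.
  apply is_derive_unique.
  apply (is_derive_plus (phi alpha) (fun x => phi alpha (2 * x))).
  - apply is_derive_phi.
  - apply is_derive_comp_double, is_derive_phi.
Qed.

Lemma Derive2_W (alpha r : R) :
  Derive_n (W alpha) 2 r =
    Derive_n (phi alpha) 2 r + 4 * Derive_n (phi alpha) 2 (2 * r).
Proof.
  change (Derive_n (W alpha) 2 r) with (Derive (Derive (W alpha)) r).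
  rewrite (Derive_ext _ _ _ (Derive_W alpha)).
  apply is_derive_unique.
  replace (4 * Derive_n (phi alpha) 2 (2 * r))
    with (2 * (2 * Derive_n (phi alpha) 2 (2 * r))) by ring.
  apply (is_derive_plus (Derive (phi alpha))
           (fun x => 2 * Derive (phi alpha) (2 * x))).
  - apply is_derive_Derive_phi.
  - apply (is_derive_scal (fun x => Derive (phi alpha) (2 * x)) r 2).
    apply is_derive_comp_double, is_derive_Derive_phi.
Qed.

(** * Total strains of the two models *)

Lemma is_series_step (n : nat) (c : R) (a : nat -> R) :
  (forall l, (l < n)%nat -> a l = c) -> (forall l, (n <= l)%nat -> a l = 0) ->
  is_series a (INR n * c).
Proof.
  revert a. induction n as [|n IH]; intros a Hc H0.
  - rewrite Rmult_0_l. unfold is_series.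
    apply filterlim_ext with (fun _ => 0); [|apply filterlim_const].
    intros m. rewrite (sum_n_ext a (fun _ => 0)) by (intros l; apply H0; lia).
    rewrite sum_n_const. symmetry. apply Rmult_0_r.
  - replace (INR (S n) * c) with (plus (INR n * c) (a 0%nat)).
    + apply is_series_decr_1.
      unfold plus; simpl. rewrite Rplus_assoc, Rplus_opp_r, Rplus_0_r.
      apply IH; intros l Hl; [apply Hc | apply H0]; lia.
    + rewrite S_INR, Hc by lia. unfold plus; simpl. ring.
Qed.

Lemma mesh_size_0_ge1 (X : nat -> nat) : is_mesh X -> 1 <= mesh_size X 0.
Proof.
  intros [_ HX]. specialize (HX 0%nat). unfold mesh_size.
  apply (le_INR 1). lia.
Qed.

(** Only the first cell carries strain, and since [X 0 = 0] it consists of exactly [mesh_size X 0]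
    sites. *)
Lemma is_series_u_scb (X : nat -> nat) (alpha : R) : is_mesh X ->
  is_series (u_scb alpha X) (mesh_size X 0 * U_scb alpha X 0).
Proof.
  intros HX. assert (H0 : X 0%nat = 0%nat) by apply HX.
  unfold mesh_size. rewrite H0, Nat.sub_0_r. apply is_series_step; intros l Hl.
  - apply (interpolate_spec X _ 0 l HX). lia.
  - unfold u_scb, interpolate. destruct (cell_spec X l HX) as [_ Hu].
    destruct (cell X l); [lia|reflexivity].
Qed.

Lemma u_scb_total (X : nat -> nat) (alpha : R) :
  is_mesh X -> 1 + sqrt 3 <= alpha ->
  mesh_size X 0 * U_scb alpha X 0 =
    Derive (phi alpha) 2 /
    (Derive_n (phi alpha) 2 1 *
     (1 + 4 * beta alpha - 2 * beta alpha / mesh_size X 0)).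
Proof.
  intros HX Ha. destruct (beta_bounds alpha Ha) as [D Hb].
  assert (Hh := mesh_size_0_ge1 X HX). cbn [U_scb].
  rewrite Derive_gamma, Derive2_gamma, Derive2_W, Rmult_1_r.
  replace (Derive_n (phi alpha) 2 2)
    with (beta alpha * Derive_n (phi alpha) 2 1)
    by (unfold beta; field; lra).
  set (d := Derive_n (phi alpha) 2 1) in *. set (b := beta alpha) in *.
  set (h := mesh_size X 0) in *.
  (* Both [h * (1 + 4 * b)] and [- 2 * b] are positive because [-1/4 < b < 0]; up to the factor [d]
     this is the denominator of [U_scb]. *)
  assert (P : 0 < h * (1 + 4 * b) - 2 * b).
  { assert (0 < h * (1 + 4 * b)) by (apply Rmult_lt_0_compat; lra). lra. }
  field. repeat split; [lra|lra|lra|].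
  replace (h * (d + 4 * (b * d)) + -2 * (b * d))
    with (d * (h * (1 + 4 * b) - 2 * b)) by ring.
  apply Rgt_not_eq. nra.
Qed.

Lemma is_series_u_a (alpha : R) : 1 + sqrt 3 <= alpha ->
  is_series (u_a alpha)
    (Derive (phi alpha) 2 /
     (Derive_n (phi alpha) 2 1 * sqrt (1 + 4 * beta alpha))).
Proof.
  intros Ha. destruct (beta_bounds alpha Ha) as [D Hb].
  destruct (proj2 (lambda_spec alpha Ha (lambda alpha)) eq_refl) as [Hl E].
  assert (Hs : 2 * beta alpha * lambda alpha
               = sqrt (1 + 4 * beta alpha) - 1 - 2 * beta alpha)
    by (unfold lambda; field; lra).
  assert (s0 : 0 < sqrt (1 + 4 * beta alpha)) by (apply sqrt_lt_R0; lra).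
  assert (B : Derive_n (phi alpha) 2 2 = beta alpha * Derive_n (phi alpha) 2 1)
    by (unfold beta; field; lra).
  rewrite B in E.
  assert (G := is_series_geom (lambda alpha)).
  rewrite Rabs_pos_eq in G by lra. specialize (G (proj2 Hl)).
  (* Up to the factor [phi''(1)], the right side expands to [1 + beta - lambda - beta * lambda ^ 2],
     which the characteristic equation turns into [1 + 2 * beta + 2 * beta * lambda], the square
     root by [Hs]. *)
  assert (K : Derive_n (phi alpha) 2 1 * sqrt (1 + 4 * beta alpha) =
    (Derive_n (phi alpha) 2 1
     + beta alpha * Derive_n (phi alpha) 2 1 * (1 + lambda alpha))
    * (1 - lambda alpha)).
  { replace (sqrt (1 + 4 * beta alpha))
      with (1 + 2 * beta alpha + 2 * beta alpha * lambda alpha) by lra.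
    lra. }
  (* The product in [K] and its factor [1 - lambda] are positive, hence so is the denominator of
     [u_a]. *)
  assert (P : 0 < Derive_n (phi alpha) 2 1
     + beta alpha * Derive_n (phi alpha) 2 1 * (1 + lambda alpha)).
  { assert (0 < Derive_n (phi alpha) 2 1 * sqrt (1 + 4 * beta alpha))
      by (apply Rmult_lt_0_compat; lra).
    apply (Rmult_lt_reg_r (1 - lambda alpha)); [lra|].
    rewrite Rmult_0_l, <- K. assumption. }
  set (c := Derive (phi alpha) 2 / (Derive_n (phi alpha) 2 1
     + beta alpha * Derive_n (phi alpha) 2 1 * (1 + lambda alpha))).
  assert (Ec : Derive (phi alpha) 2 /
     (Derive_n (phi alpha) 2 1 * sqrt (1 + 4 * beta alpha))
     = c * / (1 - lambda alpha)) by (rewrite K; unfold c; field; lra).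
  rewrite Ec.
  assert (Eu : forall l, c * lambda alpha ^ l = u_a alpha l).
  { intros l. unfold c, u_a. rewrite B. field. lra. }
  apply (is_series_ext _ _ _ Eu).
  exact (is_series_scal_l c _ _ G).
Qed.

(** * Estimates in terms of [x = exp (- alpha)] *)

(** By [exp_r0], this is [exp (- alpha * (1 - r0 alpha))] at [x = exp (- alpha)]. *)
Definition morse_ratio (x : R) : R := (1 + 2 * x) / (1 + 2 * x ^ 2).

Lemma exp_opp_lt_quarter (alpha : R) :
  1 + sqrt 3 <= alpha -> exp (- alpha) < 1 / 4.
Proof.
  intros Ha.
  assert (1 < sqrt 3) by (rewrite <- sqrt_1; apply sqrt_lt_1; lra).
  assert (1 + 1 < exp 1) by (apply exp_ineq1; lra).
  assert (2 * 2 < exp alpha).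
  { apply Rlt_le_trans with (exp (1 + 1)).
    - rewrite exp_plus. nra.
    - destruct (Rle_lt_or_eq_dec (1 + 1) alpha) as [L| <-]; [lra| |lra].
      left. apply exp_increasing. exact L. }
  rewrite exp_Ropp. apply (Rmult_lt_reg_r (exp alpha)); [lra|].
  rewrite Rinv_l; lra.
Qed.

Lemma morse_ratio_bounds (x : R) : 0 < x < 1 / 4 ->
  1 < morse_ratio x <= 1 + 2 * x.
Proof.
  intros Hx. unfold morse_ratio.
  set (q := (1 + 2 * x) / (1 + 2 * x ^ 2)).
  assert (Hq : q * (1 + 2 * x ^ 2) = 1 + 2 * x) by (unfold q; field; nra).
  assert (1 < q) by nra. split; nra.
Qed.

(** With [q = morse_ratio x], [phi'(2) = 2 * alpha * q * x * (1 - q * x)] and [0 < q * x < 1]. This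
    makes the total atomistic strain nonzero. *)
Lemma Derive_phi_2_pos (alpha : R) :
  1 + sqrt 3 <= alpha -> 0 < Derive (phi alpha) 2.
Proof.
  intros Ha. assert (Hx := exp_opp_lt_quarter alpha Ha).
  assert (0 < exp (- alpha)) by apply exp_pos.
  assert (0 <= sqrt 3) by apply sqrt_pos.
  rewrite Derive_phi. destruct (exp_split alpha) as [_ [-> ->]].
  rewrite exp_r0 by lra.
  fold (morse_ratio (exp (- alpha))). set (x := exp (- alpha)) in *.
  assert (Hq := morse_ratio_bounds x ltac:(lra)). set (q := morse_ratio x) in *.
  assert (0 < q * x < 1) by nra.
  replace (- (2 * alpha) * (q ^ 2 * x ^ 2) + 2 * alpha * (q * x))
    with (2 * alpha * ((q * x) * (1 - q * x))) by ring.
  apply Rmult_lt_0_compat; [lra|]. apply Rmult_lt_0_compat; lra.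
Qed.

(** Here [- beta = x * (1 - 2 * q * x) / (2 * q - 1)] with [q = 1 + O(x)], so [- beta] differs from
    [x] only at second order. *)
Lemma beta_asymptotics (alpha : R) : 1 + sqrt 3 <= alpha ->
  - exp (- alpha) <= beta alpha <= - exp (- alpha) + 8 * exp (- alpha) ^ 2.
Proof.
  intros Ha. assert (Hx := exp_opp_lt_quarter alpha Ha).
  assert (0 < exp (- alpha)) by apply exp_pos.
  assert (0 <= sqrt 3) by apply sqrt_pos.
  unfold beta. rewrite !Derive2_phi.
  destruct (exp_split alpha) as [-> [-> ->]].
  rewrite exp_r0 by lra.
  fold (morse_ratio (exp (- alpha))). set (x := exp (- alpha)) in *.
  assert (Hq := morse_ratio_bounds x ltac:(lra)). set (q := morse_ratio x) in *.
  replace ((4 * alpha ^ 2 * (q ^ 2 * x ^ 2) - 2 * alpha ^ 2 * (q * x)) /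
           (4 * alpha ^ 2 * q ^ 2 - 2 * alpha ^ 2 * q))
    with (- (x * (1 - 2 * q * x) / (2 * q - 1))) by (field; repeat split; nra).
  set (b := x * (1 - 2 * q * x) / (2 * q - 1)).
  assert (Hb : b * (2 * q - 1) = x * (1 - 2 * q * x)) by (unfold b; field; lra).
  assert (0 < q * x) by nra.
  assert (q * x <= 2 * x) by nra.
  assert ((x - b) * (2 * q - 1) = x * (2 * (q - 1) + 2 * (q * x))) by lra.
  (* The 8 is 4 + 4: both [2 * (q - 1)] and [2 * (q * x)] are at most [4 * x]. Dividing by
     [2 * q - 1 > 1] keeps the bound. *)
  assert (0 <= x * (2 * (q - 1) + 2 * (q * x)) <= x * (8 * x)).
  { split; [apply Rmult_le_pos; lra|apply Rmult_le_compat_l; lra]. }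
  split; nra.
Qed.

(** * Closed form and expansion of the error *)

Lemma mean_strain_error_eq (X : nat -> nat) (alpha : R) :
  is_mesh X -> 1 + sqrt 3 <= alpha ->
  mean_strain_error X alpha =
    Rabs (sqrt (1 + 4 * beta alpha) /
          (1 + 4 * beta alpha - 2 * beta alpha / mesh_size X 0) - 1).
Proof.
  intros HX Ha. destruct (beta_bounds alpha Ha) as [D Hb].
  assert (Hh := mesh_size_0_ge1 X HX).
  assert (P := Derive_phi_2_pos alpha Ha).
  assert (s0 : 0 < sqrt (1 + 4 * beta alpha)) by (apply sqrt_lt_R0; lra).
  unfold mean_strain_error.
  assert (S1 := is_series_u_scb X alpha HX). rewrite (u_scb_total X alpha HX Ha) in S1.
  assert (S2 := is_series_u_a alpha Ha).
  assert (S3 := is_series_unique _ _ (is_series_minus _ _ _ _ S1 S2)).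
  change (Series (fun l => u_scb alpha X l - u_a alpha l) =
    Derive (phi alpha) 2 / (Derive_n (phi alpha) 2 1 *
      (1 + 4 * beta alpha - 2 * beta alpha / mesh_size X 0))
    - Derive (phi alpha) 2 /
      (Derive_n (phi alpha) 2 1 * sqrt (1 + 4 * beta alpha))) in S3.
  rewrite S3, (is_series_unique _ _ S2). f_equal.
  set (h := mesh_size X 0) in *. set (b := beta alpha) in *.
  assert (0 < h * (1 + 4 * b)) by (apply Rmult_lt_0_compat; lra).
  field. repeat split; lra.
Qed.

(* [k] stands for [1 / h_0]. *)
Lemma error_expansion (b k : R) : 0 < b <= 1 / 8 -> 0 <= k <= 1 ->
  Rabs (sqrt (1 - 4 * b) / (1 - 4 * b + 2 * b * k) - 1 - 2 * (1 - k) * b)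
    <= 32 * b ^ 2.
Proof.
  intros Hb Hk.
  set (s := sqrt (1 - 4 * b)).
  assert (Hs : s * s = 1 - 4 * b) by (apply sqrt_sqrt; lra).
  assert (s0 : 0 <= s) by apply sqrt_pos.
  (* Multiplying by the conjugate [s + 1 - 2 * b], which is at least [3/4], shows that [s] is
     [1 - 2 * b] up to second order. *)
  assert (He : - (8 * b ^ 2) <= s - 1 + 2 * b <= 0).
  { assert ((s - 1 + 2 * b) * (s + 1 - 2 * b) = - (4 * b ^ 2)) by nra.
    split; nra. }
  assert (0 <= b * k <= b) by nra.
  set (D := 1 - 4 * b + 2 * b * k).
  assert (HD : 1 / 2 <= D) by (unfold D; lra).
  (* After multiplication by [D] the first-order terms cancel; the remainder lies within [8 * b ^ 2]
     of zero, and [D >= 1/2] at most doubles it. *)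
  assert (N : s - D - 2 * (1 - k) * b * D =
              (s - 1 + 2 * b) + 2 * ((b - b * k) * (4 * b - 2 * (b * k))))
    by (unfold D; ring).
  assert (0 <= (b - b * k) * (4 * b - 2 * (b * k)) <= 4 * b ^ 2) by nra.
  set (A := s / D - 1 - 2 * (1 - k) * b).
  assert (HA : A * D = s - D - 2 * (1 - k) * b * D) by (unfold A; field; lra).
  apply Rabs_le. split; nra.
Qed.

(** [Series] and division are total functions, so convergence and a nonzero denominator are stated
    explicitly to give the error its intended meaning. *)
Theorem proposition5 (X : nat -> nat) (HX : is_mesh X) :
  (forall alpha : R, 1 + sqrt 3 <= alpha ->
     ex_series (fun l : nat => u_scb alpha X l - u_a alpha l) /\
     ex_series (u_a alpha) /\
     Series (u_a alpha) <> 0) /\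
  bigO_at_infinity
    (fun alpha : R => mean_strain_error X alpha
                      - 2 * (1 - 1 / mesh_size X 0) * exp (- alpha))
    (fun alpha : R => exp (- (2 * alpha))).
Proof.
  split.
  - intros alpha Ha. destruct (beta_bounds alpha Ha) as [D Hb].
    assert (P := Derive_phi_2_pos alpha Ha).
    assert (s0 : 0 < sqrt (1 + 4 * beta alpha)) by (apply sqrt_lt_R0; lra).
    assert (S2 := is_series_u_a alpha Ha). repeat split.
    + eexists. exact (is_series_minus _ _ _ _ (is_series_u_scb X alpha HX) S2).
    + eexists. exact S2.
    + rewrite (is_series_unique _ _ S2). apply Rgt_not_eq.
      apply Rdiv_lt_0_compat; [exact P|]. apply Rmult_lt_0_compat; lra.
  (* The constant is 32 from [error_expansion] plus [2 * 8] from replacing [- beta alpha] by [x] in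
     the leading term. Beyond 3, both [1 + sqrt 3 <= alpha] and [x < 1/8] hold. *)
  - exists 48, 3. intros alpha Ha3.
    assert (sqrt 3 <= 2).
    { apply Rsqr_incr_0_var; [rewrite Rsqr_sqrt; unfold Rsqr; lra|lra]. }
    assert (Ha : 1 + sqrt 3 <= alpha) by lra.
    rewrite (mean_strain_error_eq X alpha HX Ha).
    rewrite (Rabs_pos_eq (exp _)) by (left; apply exp_pos).
    replace (exp (- (2 * alpha))) with (exp (- alpha) ^ 2)
      by (simpl; rewrite Rmult_1_r, <- exp_plus; f_equal; ring).
    destruct (beta_bounds alpha Ha) as [_ Hb].
    assert (Ba := beta_asymptotics alpha Ha).
    assert (x0 : 0 < exp (- alpha)) by apply exp_pos.
    assert (x1 : exp (- alpha) < 1 / 8).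
    { assert (1 + 1 < exp 1) by (apply exp_ineq1; lra).
      assert (2 * 2 * 2 < exp (1 + 1 + 1)) by (rewrite !exp_plus; nra).
      assert (exp (1 + 1 + 1) < exp alpha) by (apply exp_increasing; lra).
      rewrite exp_Ropp. apply (Rmult_lt_reg_r (exp alpha)); [lra|].
      rewrite Rinv_l; lra. }
    set (x := exp (- alpha)) in *.
    assert (Hh := mesh_size_0_ge1 X HX).
    set (k := 1 / mesh_size X 0).
    assert (Hk : 0 <= k <= 1).
    { unfold k. split; [apply Rdiv_le_0_compat; lra|].
      apply Rle_div_l; lra. }
    (* The bound [- beta alpha <= 1/8] follows from [- beta alpha <= x < 1/8]. *)
    assert (E := error_expansion (- beta alpha) k ltac:(lra) Hk).
    replace (1 - 4 * - beta alpha) with (1 + 4 * beta alpha) in E by ring.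
    replace (1 + 4 * beta alpha - 2 * beta alpha / mesh_size X 0)
      with (1 + 4 * beta alpha + 2 * - beta alpha * k)
      by (unfold k; field; lra).
    set (A := sqrt _ / _ - 1) in *.
    (* The leading term is nonnegative, so the outer absolute value only helps. *)
    assert (L : 0 <= 2 * (1 - k) * x) by nra.
    rewrite <- (Rabs_pos_eq _ L).
    eapply Rle_trans; [apply Rabs_triang_inv2|].
    apply Rabs_le_between in E.
    assert (0 <= (1 - k) * (x - - beta alpha) <= 8 * x ^ 2) by nra.
    assert ((- beta alpha) ^ 2 <= x ^ 2) by nra.
    apply Rabs_le. lra.
Qed.
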